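(* For every integer $t\geq 2$, \[\sum_{n=0}^{\infty}b_{t,1}(n)q^n=\frac{(q^t;q^t)_{\infty}}{(q;q)_{\infty}}\left(\frac{q}{1-q}-\frac{q^t}{1-q^t}\right)\] as formal power series in $q$.
   Context: For an integer $t\geq2$, a $t$-regular partition of $n$ is a partition of $n$ none of whose parts is divisible by $t$. The hook length of a box in the Young diagram of a partition (rows of lengths $\lambda_1\geq\lambda_2\geq\cdots$, left-justified) is the number of boxes directly to its right plus the number directly below it plus $1$. For integers $t\geq2$, $k\geq1$, $b_{t,k}(n)$ denotes the total number of boxes of hook length $k$, counted over all $t$-regular partitions of $n$ ($b_{t,k}(0)=0$). Notation: $(a;q)_\infty=\prod_{j\geq0}(1-aq^j)$. *)

(* Defs.v *)
From HB Require Import structures.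
From mathcomp Require Import all_boot all_order all_algebra.
From mathcomp Require Import boolp classical_sets.

Set Implicit Arguments.
Unset Strict Implicit.
Unset Printing Implicit Defensive.

Import GRing.Theory.

Section Partitions.
Local Open Scope nat_scope.

Definition is_partition (n : nat) (s : seq nat) : bool :=
  [&& sorted geq s, all (leq 1) s & sumn s == n].

Definition is_regular (t : nat) (s : seq nat) : bool :=
  all (fun p => ~~ (t %| p)) s.

(* Rows and columns are numbered from 0: the boxes of the diagram of s are the
   (i, j) with i < size s and j < nth 0 s i. *)
Definition arm (s : seq nat) (i j : nat) : nat := nth 0 s i - j.+1.
Definition leg (s : seq nat) (i j : nat) : nat :=
  count (fun p => j < p) (drop i.+1 s).
Definition hook_length (s : seq nat) (i j : nat) : nat :=
  arm s i j + leg s i j + 1.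

Definition hook_count (k : nat) (s : seq nat) : nat :=
  \sum_(i < size s) \sum_(j < nth 0 s i) (hook_length s i j == k).

Definition nat_parts (n : nat) (s : n.-bseq 'I_n.+1) : seq nat :=
  [seq val x | x <- s].

(* A partition of n has at most n parts, each at most n, so the finite type
   n.-bseq 'I_n.+1 contains all of them; see is_partition_nat_parts. *)
Definition bhook (t k n : nat) : nat :=
  \sum_(s : n.-bseq 'I_n.+1 |
        is_partition n (nat_parts s) && is_regular t (nat_parts s))
     hook_count k (nat_parts s).

Lemma nat_parts_inj n : injective (@nat_parts n).
Proof. by move=> s1 s2 /(inj_map val_inj) /val_inj. Qed.

Lemma is_partition_nat_parts n s :
  is_partition n s -> exists s' : n.-bseq 'I_n.+1, nat_parts s' = s.
Proof.
case/and3P=> _ s_gt0 /eqP s_sum.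
have le_size : size s <= n.
  rewrite -{}s_sum; elim: s s_gt0 => //= x s IHs /andP[x_gt0 /IHs le_s].
  by rewrite -add1n leq_add.
have le_parts : {in s, forall p, p < n.+1}.
  rewrite -{}s_sum => p {s_gt0 le_size}.
  elim: s => //= x s IHs; rewrite inE => /predU1P[->|/IHs le_p].
    by rewrite ltnS leq_addr.
  by rewrite (leq_trans le_p) // ltnS leq_addl.
have sz' : size [seq (inord p : 'I_n.+1) | p <- s] <= n by rewrite size_map.
exists (Bseq sz'); rewrite /nat_parts /= -map_comp -[RHS]map_id.
by apply/eq_in_map => p /le_parts lt_p; rewrite /= inordK.
Qed.

End Partitions.

Local Open Scope ring_scope.

(* Formal power series, given by their coefficients, with the Cauchy product;
   a record, so as not to meet the pointwise product on functions. *)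
Record fps (R : Type) := Fps { fcoef : nat -> R }.

HB.instance Definition _ (R : Type) := gen_eqMixin (fps R).
HB.instance Definition _ (R : Type) := gen_choiceMixin (fps R).

Lemma fpsP (R : Type) (f g : fps R) : fcoef f =1 fcoef g -> f = g.
Proof. by case: f g => [f] [g] /= /funext ->. Qed.

Section FpsZmodule.
Variable R : zmodType.
Implicit Types f g h : fps R.

Definition fps_zero : fps R := Fps (fun=> 0).
Definition fps_opp f : fps R := Fps (fun n => - fcoef f n).
Definition fps_add f g : fps R := Fps (fun n => fcoef f n + fcoef g n).

Lemma fps_addA : associative fps_add.
Proof. by move=> f g h; apply: fpsP => n /=; rewrite addrA. Qed.
Lemma fps_addC : commutative fps_add.
Proof. by move=> f g; apply: fpsP => n /=; rewrite addrC. Qed.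
Lemma fps_add0 : left_id fps_zero fps_add.
Proof. by move=> f; apply: fpsP => n /=; rewrite add0r. Qed.
Lemma fps_addN : left_inverse fps_zero fps_opp fps_add.
Proof. by move=> f; apply: fpsP => n /=; rewrite addNr. Qed.

HB.instance Definition _ :=
  GRing.isZmodule.Build (fps R) fps_addA fps_addC fps_add0 fps_addN.

End FpsZmodule.

Section FpsRing.
Variable R : comNzRingType.
Implicit Types f g h : fps R.

Definition fps_one : fps R := Fps (fun n => (n == 0%N)%:R).
Definition fps_mul f g : fps R :=
  Fps (fun n => \sum_(i < n.+1) fcoef f i * fcoef g (n - i)).

Let trunc N f : {poly R} := \poly_(i < N.+1) fcoef f i.

Let coef_trunc N f i : (i <= N)%N -> (trunc N f)`_i = fcoef f i.
Proof. by move=> le_iN; rewrite coef_poly ltnS le_iN. Qed.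

Let fps_mulE N f g i : (i <= N)%N ->
  fcoef (fps_mul f g) i = (trunc N f * trunc N g)`_i.
Proof.
move=> le_iN; rewrite coefM; apply: eq_bigr => j _.
rewrite !coef_trunc ?(leq_trans (leq_subr _ _)) //.
by rewrite (leq_trans _ le_iN) // -ltnS.
Qed.

Lemma fps_mulC : commutative fps_mul.
Proof. by move=> f g; apply: fpsP => n; rewrite !(fps_mulE _ _ (leqnn n)) mulrC. Qed.

Lemma fps_mulA : associative fps_mul.
Proof.
move=> f g h; apply: fpsP => n.
have le_ord (j : 'I_n.+1) : (j <= n)%N by rewrite -ltnS.
transitivity (trunc n f * trunc n g * trunc n h)`_n; last first.
  rewrite coefM; apply: eq_bigr => j _.
  by rewrite (fps_mulE _ _ (le_ord j)) coef_trunc ?leq_subr.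
rewrite -mulrA coefM; apply: eq_bigr => j _.
by rewrite (fps_mulE _ _ (leq_subr j n)) coef_trunc.
Qed.

Lemma fps_mul1 : left_id fps_one fps_mul.
Proof.
move=> f; apply: fpsP => n /=; rewrite big_ord_recl /= mul1r subn0.
by rewrite big1 ?addr0 // => i _; rewrite mul0r.
Qed.

Lemma fps_mulDl : left_distributive fps_mul (@fps_add R).
Proof.
move=> f g h; apply: fpsP => n /=; rewrite -big_split.
by apply: eq_bigr => i _; rewrite mulrDl.
Qed.

Lemma fps_one_neq0 : fps_one != 0.
Proof.
apply/eqP => /(congr1 (fun f => fcoef f 0)) /eqP.
by rewrite /= oner_eq0.
Qed.

HB.instance Definition _ := GRing.Zmodule_isComNzRing.Build (fps R)
  fps_mulA fps_mulC fps_mul1 fps_mulDl fps_one_neq0.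

Definition fpsX : fps R := Fps (fun n => (n == 1%N)%:R).

Lemma fcoef0 n : fcoef (0 : fps R) n = 0. Proof. by []. Qed.
Lemma fcoef1 n : fcoef (1 : fps R) n = (n == 0%N)%:R. Proof. by []. Qed.
Lemma fcoefD f g n : fcoef (f + g) n = fcoef f n + fcoef g n. Proof. by []. Qed.
Lemma fcoefN f n : fcoef (- f) n = - fcoef f n. Proof. by []. Qed.
Lemma fcoefM f g n :
  fcoef (f * g) n = \sum_(i < n.+1) fcoef f i * fcoef g (n - i).
Proof. by []. Qed.

End FpsRing.

Section FpsUnitRing.
Variable R : comUnitRingType.
Implicit Types f g h : fps R.

Definition fps_unit : {pred fps R} := [pred f | fcoef f 0 \is a GRing.unit].

(* The first n.+1 coefficients of the inverse g of f, obtained by solving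
   f_0 g_n = - \sum_(1 <= i <= n) f_i g_(n - i) successively. *)
Fixpoint fps_inv_coefs f (n : nat) : seq R :=
  if n is m.+1 then
    let s := fps_inv_coefs f m in
    rcons s (- (fcoef f 0)^-1 * \sum_(i < m.+1) fcoef f i.+1 * s`_(m - i))
  else [:: (fcoef f 0)^-1].

Definition fps_inv f : fps R :=
  if f \in fps_unit then Fps (fun n => (fps_inv_coefs f n)`_n) else f.

Lemma size_fps_inv_coefs f n : size (fps_inv_coefs f n) = n.+1.
Proof. by elim: n => //= n IHn; rewrite size_rcons IHn. Qed.

Lemma nth_fps_inv_coefs f n i : (i <= n)%N ->
  (fps_inv_coefs f n)`_i = (fps_inv_coefs f i)`_i.
Proof.
elim: n => [|n IHn]; first by rewrite leqn0 => /eqP->.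
rewrite leq_eqVlt => /predU1P[-> // | lt_in].
by rewrite /= nth_rcons size_fps_inv_coefs lt_in IHn.
Qed.

Lemma fps_mulV : {in fps_unit, left_inverse 1 fps_inv *%R}.
Proof.
move=> f uf; rewrite mulrC; apply: fpsP => n; rewrite fcoefM /fps_inv uf /=.
rewrite big_ord_recl /= subn0; case: n => [|n].
  by rewrite big_ord0 addr0 /= mulrV.
rewrite /= nth_rcons size_fps_inv_coefs ltnn eqxx mulrA mulrN mulrV // mulN1r.
apply/eqP; rewrite addrC subr_eq0; apply/eqP; apply: eq_bigr => i _.
by rewrite [bump _ _]add1n subSS (nth_fps_inv_coefs _ (leq_subr i n)).
Qed.

Lemma fps_unitPl f g : g * f = 1 -> fps_unit f.
Proof.
move=> /(congr1 (fun h => fcoef h 0)); rewrite fcoefM big_ord1 /= => gf1.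
by apply/unitrP; exists (fcoef g 0); split; [|rewrite mulrC]; exact: gf1.
Qed.

Lemma fps_inv_out : {in [predC fps_unit], fps_inv =1 id}.
Proof. by move=> f; rewrite inE /fps_inv => /negbTE->. Qed.

HB.instance Definition _ := GRing.ComNzRing_hasMulInverse.Build (fps R)
  fps_mulV fps_unitPl fps_inv_out.

Lemma fps_unitE f : (f \is a GRing.unit) = (fcoef f 0 \is a GRing.unit).
Proof. by []. Qed.

End FpsUnitRing.

Section FpsLimit.
Variable R : comNzRingType.

(* Convergence in the usual (X-adic) topology of formal power series: each
   coefficient is eventually constant. *)
Definition fps_cvg (u : nat -> fps R) (f : fps R) : Prop :=
  forall n, exists N, forall m, (N <= m)%N -> fcoef (u m) n = fcoef f n.

Definition fps_lim (u : nat -> fps R) : fps R := xget 0 [set f | fps_cvg u f].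

Lemma fps_cvg_unique u f g : fps_cvg u f -> fps_cvg u g -> f = g.
Proof.
move=> uf ug; apply: fpsP => n; have [[N ufN] [M ugM]] := (uf n, ug n).
by rewrite -(ufN (maxn N M)) ?leq_maxl // ugM ?leq_maxr.
Qed.

Lemma fps_limE u f : fps_cvg u f -> fps_lim u = f.
Proof. by move=> uf; apply: xget_unique => // g /fps_cvg_unique; apply. Qed.

Definition qpoch_inf (a q : fps R) : fps R :=
  fps_lim (fun N => \prod_(j < N) (1 - a * q ^+ j)).

Lemma fcoef_exp_lt (q : fps R) j n :
  fcoef q 0 = 0 -> (n < j)%N -> fcoef (q ^+ j) n = 0.
Proof.
move=> q0; elim: j n => // j IHj n; rewrite ltnS => le_nj.
rewrite exprS fcoefM big_ord_recl /= q0 mul0r add0r big1 // => i _.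
by rewrite IHj ?mulr0 // (leq_trans _ le_nj) // subnSK ?leq_subr.
Qed.

Lemma qpoch_inf_cvg (a q : fps R) : fcoef q 0 = 0 ->
  fps_cvg (fun N => \prod_(j < N) (1 - a * q ^+ j)) (qpoch_inf a q).
Proof.
move=> q0; set u := fun N => _.
have u_st n m : (n < m)%N -> fcoef (u m) n = fcoef (u n.+1) n.
  elim: m => // m IHm; rewrite ltnS leq_eqVlt => /predU1P[-> // | lt_nm].
  have -> : u m.+1 = u m * (1 - a * q ^+ m) by rewrite /u big_ord_recr.
  rewrite -(IHm lt_nm) mulrBr mulr1 fcoefD fcoefN mulrA.
  rewrite [X in _ - X]fcoefM big1 ?subr0 // => i _.
  by rewrite fcoef_exp_lt ?mulr0 // (leq_ltn_trans (leq_subr _ _)).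
have uf : fps_cvg u (Fps (fun n => fcoef (u n.+1) n)).
  by move=> n; exists n.+1 => m; apply: u_st.
by rewrite /qpoch_inf (fps_limE uf).
Qed.

End FpsLimit.

Arguments fpsX {R}.

(* Main.v *)
Require Import Defs.
From mathcomp Require Import all_boot all_order all_algebra.
Import GRing.Theory.
Local Open Scope ring_scope.

(** A box of hook length 1 is the last box of the last row of a given length,
    so a partition has as many of them as it has distinct part sizes.  Removing
    one copy of [m] is a bijection from the partitions of [n] with parts in [A]
    that contain [m] onto those of [n - m], when [A m].  Summed over [m], this
    expresses the generating function of the number of distinct parts as
    [G_A * \sum_(A m) q^m], where [G_A] counts the partitions with parts in [A];
    for a single [m] it gives [G_A * (1 - q^m) = G_(A \ m)], from which the
    product formula for [G_A] follows by removing the parts one at a time. *)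

Lemma geq_total : total geq. Proof. by move=> a b; apply: leq_total. Qed.
Lemma geq_trans : transitive geq.
Proof. by move=> a b c /= ba ac; apply: leq_trans ac ba. Qed.
Lemma geq_anti : antisymmetric geq.
Proof. by move=> a b /= /anti_leq. Qed.

(** The hook of a box only involves its own row and the rows below, so a new top row leaves the
    other hooks unchanged. In the induction only the new row matters: it has one box of hook length
    1 if its length does not recur in [s], and none otherwise. *)
Lemma hook_count1 (s : seq nat) : sorted geq s -> all (leq 1) s ->
  hook_count 1 s = size (undup s).
Proof.
elim: s => [|x s IHs] s_sorted /=; first by rewrite /hook_count big_ord0.
case/andP=> x_gt0 s_gt0.
have x_max : all (geq x) s.
  exact: order_path_min geq_trans s_sorted.
rewrite /hook_count /= big_ord_recl /= -[X in (_ + X)%N]/(hook_count 1 s).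
rewrite IHs ?(path_sorted s_sorted) //.
suff -> : (\sum_(j < x) (hook_length (x :: s) 0 j == 1))%N = (x \notin s).
  by case: (x \in s).
case: x x_gt0 x_max {s_sorted} => // x _ x_max.
(* Every box but the last of the row has a positive arm. The last one has arm 0, and its leg
   vanishes iff no lower row has length at least [x.+1], which by [x_max] means equal to [x.+1]. *)
rewrite big_ord_recr big1 /= => [|j _]; last first.
  by rewrite /hook_length /arm /= subSS addn1 eqSS addn_eq0 subn_eq0 leqNgt ltn_ord.
rewrite /hook_length /arm /leg /= subnn drop0 addn1 eqSS add0n.
rewrite eqn0Ngt -has_count; congr (nat_of_bool (~~ _)).
apply/hasP/idP => [[p sp lt_xp]|sx]; last by exists x.+1.
by rewrite (@anti_leq x.+1 p) //; apply/andP; split; last exact: (allP x_max).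
Qed.

(** Mapping into [seq nat] puts the partitions of different [n] in one type, so that inserting a
    part is an ordinary map between these lists. *)
Definition partitions (A : pred nat) (n : nat) : seq (seq nat) :=
  [seq nat_parts s | s <- enum {: n.-bseq 'I_n.+1} &
                     is_partition n (nat_parts s) && all A (nat_parts s)].

Lemma partitions_uniq A n : uniq (partitions A n).
Proof.
rewrite map_inj_uniq; last exact: nat_parts_inj.
by rewrite filter_uniq ?enum_uniq.
Qed.

Lemma mem_partitions A n s :
  (s \in partitions A n) = is_partition n s && all A s.
Proof.
apply/mapP/idP => [[s']|ps]; first by rewrite mem_filter => /andP[? _] ->.
have [s' def_s] := is_partition_nat_parts (proj1 (andP ps)).
by exists s'; rewrite // mem_filter def_s ps mem_enum.
Qed.

Lemma bhookE t k n :
  bhook t k n = (\sum_(s <- partitions (fun p => ~~ (t %| p)) n) hook_count k s)%N.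
Proof. by rewrite /bhook big_map big_filter big_enum_cond. Qed.

Lemma partition_part_bounds {n s p} : is_partition n s -> p \in s -> (0 < p <= n)%N.
Proof.
case/and3P=> _ s_gt0 /eqP <- sp; rewrite (allP s_gt0) //=.
by rewrite sumnE (big_rem p sp) leq_addr.
Qed.

Lemma eq_size_partitions A B n :
    (forall p, (0 < p <= n)%N -> A p = B p) ->
  size (partitions A n) = size (partitions B n).
Proof.
move=> eqAB; apply/perm_size/uniq_perm; rewrite ?partitions_uniq // => s.
rewrite !mem_partitions; case ps: (is_partition n s) => //=.
by apply: eq_in_all => p /(partition_part_bounds ps)/eqAB.
Qed.

Definition insert_part (m : nat) (s : seq nat) : seq nat := sort geq (m :: s).

Lemma count_part (A : pred nat) m n : A m -> (0 < m)%N ->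
  count (fun s => m \in s) (partitions A n) =
  if (m <= n)%N then size (partitions A (n - m)) else 0%N.
Proof.
move=> Am m_gt0; case: leqP => [le_mn|lt_nm]; last first.
  apply/eqP; rewrite eqn0Ngt -has_count; apply/hasPn => s.
  rewrite mem_partitions => /andP[ps _]; apply/negP => /(partition_part_bounds ps).
  by rewrite [(m <= n)%N]leqNgt lt_nm andbF.
rewrite -size_filter -(size_map (insert_part m)).
have insE s : perm_eq (insert_part m s) (m :: s) by rewrite perm_sort.
apply/perm_size/uniq_perm; first by rewrite filter_uniq ?partitions_uniq.
  rewrite map_inj_in_uniq ?partitions_uniq // => s1 s2.
  rewrite !mem_partitions => /andP[/and3P[s1s _ _] _] /andP[/and3P[s2s _ _] _] eq12.
  (* A sorted sequence is determined by its multiset of entries, and [m] cancels from both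
     multisets. *)
  apply: (sorted_eq geq_trans geq_anti) s1s s2s _.
  by rewrite -(perm_cons m) -(permPl (insE s1)) eq12 insE.
move=> s; rewrite mem_filter mem_partitions.
apply/andP/mapP => [[sm /andP[/and3P[ss s_gt0 /eqP s_sum] sA]]|[s' + ->]].
  exists (rem m s); last first.
    apply: (sorted_eq geq_trans geq_anti) ss (sort_sorted geq_total _) _.
    by rewrite (perm_trans (perm_to_rem sm)) // perm_sym insE.
  rewrite mem_partitions /is_partition (subseq_sorted geq_trans (rem_subseq m s)) //=.
  move: s_gt0 sA s_sum; rewrite !(perm_all _ (perm_to_rem sm)).
  rewrite (perm_sumn (perm_to_rem sm)) /= => /andP[_ ->] /andP[_ ->] <-.
  by rewrite addKn eqxx.
rewrite mem_partitions => /andP[/and3P[ss s_gt0 /eqP s_sum] sA].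
rewrite (perm_mem (insE s')) mem_head /is_partition sort_sorted; last exact: geq_total.
rewrite !(perm_all _ (insE s')) /= m_gt0 s_gt0 Am sA !andbT.
by rewrite (perm_sumn (insE s')) /= s_sum subnKC.
Qed.

(** Split according to whether [m] is a part: [count_part] handles the partitions that contain it,
    and the others are those with parts in [A] without [m]. *)
Lemma size_partitionsD1 (A : pred nat) m n : A m -> (0 < m)%N ->
  size (partitions A n) =
  (size (partitions [predD1 A & m] n) +
    if m <= n then size (partitions A (n - m)) else 0)%N.
Proof.
move=> Am m_gt0; rewrite -count_part // addnC.
rewrite -(count_predC (fun s : seq nat => m \in s)); congr (_ + _)%N.
rewrite -size_filter; apply/perm_size/uniq_perm; rewrite ?filter_uniq ?partitions_uniq //.
move=> s; rewrite mem_filter !mem_partitions /= andbCA; congr (_ && _).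
apply/andP/allP => [[sm /allP sA] p sp /=|sA].
  by apply/andP; split; [apply: contraNneq sm => <-|apply: sA].
split; last by apply/allP=> p /sA /andP[].
by apply/negP => /sA /=; rewrite eqxx.
Qed.

(** Double counting of the pairs of a partition [s] and a part size [m] of [s]; for fixed [m],
    [count_part] applies. *)
Lemma sum_size_undup_partitions (A : pred nat) n :
  (\sum_(s <- partitions A n) size (undup s) =
   \sum_(m < n.+1 | (0 < m) && A m) size (partitions A (n - m)))%N.
Proof.
transitivity (\sum_(s <- partitions A n)
    \sum_(m < n.+1 | (0 < m) && A m) (nat_of_ord m \in s))%N.
  apply: eq_big_seq => s; rewrite mem_partitions => /andP[ps /allP sA].
  rewrite -(big_mkord (fun m => (0 < m)%N && A m) (fun m => nat_of_bool (m \in s))).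
  rewrite -big_mkcondr /= sum1_count -size_filter.
  apply/perm_size/uniq_perm; rewrite ?undup_uniq ?filter_uniq ?iota_uniq // => p.
  rewrite mem_undup mem_filter mem_index_iota /=.
  case sp: (p \in s); rewrite ?andbF //= andbT (sA p sp).
  by have /andP[-> ] := partition_part_bounds ps sp.
rewrite exchange_big /=; apply: eq_bigr => m /andP[m_gt0 Am].
by rewrite -big_mkcond sum1_count count_part // -ltnS ltn_ord.
Qed.

Local Notation q := (fpsX : fps int).

Definition partition_gf (A : pred nat) : fps int :=
  Fps (fun n => (size (partitions A n))%:Z).

Lemma fcoef_fpsXM (R : comNzRingType) (f : fps R) k n :
  fcoef (fpsX ^+ k * f) n = if (k <= n)%N then fcoef f (n - k) else 0.
Proof.
have fcoefXM (g : fps R) i : fcoef (fpsX * g) i.+1 = fcoef g i.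
  rewrite fcoefM 2!big_ord_recl /= mulr0n mul0r add0r mul1r subn1 /=.
  by rewrite big1 ?addr0 // => j _; rewrite mul0r.
elim: k n => [|k IHk] n; first by rewrite expr0 mul1r subn0.
rewrite exprS -mulrA; case: n => [|n]; first by rewrite fcoefM big_ord1 /= mul0r.
by rewrite fcoefXM IHk ltnS subSS.
Qed.

Lemma fcoef_fpsXn (R : comNzRingType) k n :
  fcoef (fpsX ^+ k : fps R) n = (n == k)%:R.
Proof.
rewrite -[_ ^+ k]mulr1 fcoef_fpsXM fcoef1 subn_eq0 eqn_leq andbC.
by case: leqP; rewrite ?andbT.
Qed.

Lemma partition_gfD1 (A : pred nat) m : A m -> (0 < m)%N ->
  partition_gf A * (1 - fpsX ^+ m) = partition_gf [predD1 A & m].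
Proof.
move=> Am m_gt0; apply: fpsP => n.
rewrite mulrBr mulr1 mulrC fcoefD fcoefN fcoef_fpsXM /=.
rewrite (size_partitionsD1 A m n) // PoszD.
by case: leqP => _; rewrite ?addrK ?addr0 ?subr0.
Qed.

Lemma eq_partition_gf (A B : pred nat) : (forall p, (0 < p)%N -> A p = B p) ->
  partition_gf A = partition_gf B.
Proof.
move=> eqAB; apply: fpsP => n /=; congr Posz.
by apply: eq_size_partitions => p /andP[/eqAB].
Qed.

Lemma partition_gf_pred0 : partition_gf pred0 = 1.
Proof.
apply: fpsP => n; rewrite fcoef1 /=.
suff ->: size (partitions pred0 n) = (n == 0%N) by case: (n == 0%N).
transitivity (size (if n == 0%N then [:: [::]] else [::] : seq (seq nat))); last by case: eqP.
apply/perm_size/uniq_perm; rewrite ?partitions_uniq //; first by case: eqP.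
move=> [|p s]; rewrite mem_partitions ?andbF //=; last by case: eqP.
by rewrite /is_partition /= andbT eq_sym; case: eqP.
Qed.

(** A coefficient of a Cauchy product involves all lower coefficients of both factors, so a rank
    valid for all of them at once is needed in [fps_cvgM]. *)
Lemma fps_cvg_uniform {R : comNzRingType} {u : nat -> fps R} {f} : fps_cvg u f ->
  forall n, exists N, forall m, (N <= m)%N ->
    forall i, (i <= n)%N -> fcoef (u m) i = fcoef f i.
Proof.
move=> uf; elim=> [|n [N uN]].
  by have [N uN] := uf 0%N; exists N => m /uN ? i; rewrite leqn0 => /eqP ->.
have [M uM] := uf n.+1; exists (maxn N M) => m; rewrite geq_max => /andP[Nm Mm] i.
by rewrite leq_eqVlt => /predU1P[->|]; [apply: uM | apply: uN].
Qed.

Lemma fps_cvgM (R : comNzRingType) (u v : nat -> fps R) f g :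
  fps_cvg u f -> fps_cvg v g -> fps_cvg (fun N => u N * v N) (f * g).
Proof.
move=> /fps_cvg_uniform uf /fps_cvg_uniform vg n.
have [[N uN] [M vM]] := (uf n, vg n).
exists (maxn N M) => m; rewrite geq_max => /andP[Nm Mm].
rewrite !fcoefM; apply: eq_bigr => i _.
by rewrite uN ?vM ?leq_subr // -ltnS.
Qed.

(** Induction on [N], the new factor on the left being [1 - q ^+ N.+1]. If [t] divides [N.+1], the
    allowed parts do not change and the factor reappears on the right; otherwise it removes the
    newly allowed part [N.+1], by [partition_gfD1]. *)
Lemma partition_gf_truncated t N : (0 < t)%N ->
  partition_gf (fun p => (p <= N)%N && ~~ (t %| p)%N) *
    \prod_(j < N) (1 - q * q ^+ j) =
  \prod_(j < N %/ t) (1 - q ^+ t * (q ^+ t) ^+ j).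
Proof.
move=> t_gt0; elim: N => [|N IHN].
  rewrite div0n !big_ord0 mulr1 -partition_gf_pred0.
  by apply: eq_partition_gf => p; rewrite lt0n leqn0 => /negPf ->.
rewrite big_ord_recr /= -exprS divnS //.
case tN: (t %| N.+1)%N => /=.
  rewrite add1n big_ord_recr /= -IHN mulrA -exprS -exprM.
  have -> : (t * (N %/ t).+1 = N.+1)%N.
    by rewrite -add1n -[1%N](congr1 nat_of_bool tN) -divnS // mulnC divnK.
  congr (_ * _ * _); apply: eq_partition_gf => p _.
  by rewrite [(p <= N.+1)%N]leq_eqVlt ltnS; case: eqP => [->|] //=; rewrite tN andbF.
rewrite add0n -IHN mulrCA mulrC; congr (_ * _).
rewrite partition_gfD1 /= ?leqnn ?tN //; apply: eq_partition_gf => p _ /=.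
by rewrite unfold_in [(p <= N.+1)%N]leq_eqVlt ltnS; case: eqP => [->|] //=; rewrite ltnn.
Qed.

Lemma partition_gf_regular t : (0 < t)%N ->
  partition_gf (fun p => ~~ (t %| p)%N) * qpoch_inf q q = qpoch_inf (q ^+ t) (q ^+ t).
Proof.
move=> t_gt0; apply: (@fps_cvg_unique _
  (fun N => partition_gf (fun p => (p <= N)%N && ~~ (t %| p)%N) *
    \prod_(j < N) (1 - q * q ^+ j))).
  apply: fps_cvgM; last exact: qpoch_inf_cvg.
  (* The bound [p <= m] excludes no part of a partition of [n] once [n <= m]. *)
  move=> n; exists n => m le_nm /=; congr Posz; apply: eq_size_partitions => p.
  by case/andP=> _ le_pn; rewrite (leq_trans le_pn).
have qt0 : fcoef (q ^+ t) 0 = 0 by rewrite fcoef_exp_lt.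
move=> n; have [N cN] := qpoch_inf_cvg (q ^+ t) qt0 n; exists (N * t)%N => m le_m.
by rewrite partition_gf_truncated //; apply: cN; rewrite leq_divRL.
Qed.

Lemma fps_geometric k : (0 < k)%N ->
  (fpsX ^+ k / (1 - fpsX ^+ k) : fps int) =
  Fps (fun n => ((0 < n) && (k %| n))%N%:R).
Proof.
move=> k_gt0; have u : (1 - fpsX ^+ k : fps int) \is a GRing.unit.
  by rewrite fps_unitE fcoefD fcoefN fcoef_exp_lt // subr0 unitr1.
apply: (mulIr u); rewrite divrK //; apply: fpsP => n.
rewrite mulrBr mulr1 mulrC fcoefD fcoefN fcoef_fpsXM fcoef_fpsXn /=.
case: (leqP k n) => [le_kn|lt_nk].
  rewrite dvdn_subl // subn_gt0 (leq_trans k_gt0 le_kn) /=.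
  (* For [k < n] the indicator of the positive multiples of [k] cancels against its shift; at
     [n = k] the shifted index is 0, which is not positive, so the coefficient 1 remains. *)
  case: ltngtP le_kn => // [_|<-] _; first by rewrite subrr.
  by rewrite dvdnn subr0.
rewrite ltn_eqF // subr0; case: n lt_nk => //= n lt_nk.
by rewrite gtnNdvd.
Qed.

Theorem theorem1p2 (t : nat) (ht : (2 <= t)%N) :
  let q : fps int := fpsX in
  Fps (fun n => (bhook t 1 n)%:Z) =
    qpoch_inf (q ^+ t) (q ^+ t) / qpoch_inf q q
      * (q / (1 - q) - q ^+ t / (1 - q ^+ t)).
Proof.
move=> q; have t_gt0 : (0 < t)%N by apply: ltnW.
(* The constant coefficient agrees with that of a finite product of factors with constant
   coefficient 1. *)
have u : qpoch_inf q q \is a GRing.unit.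
  rewrite fps_unitE; have [N /(_ _ (leqnn _)) <-] := @qpoch_inf_cvg _ q q (erefl _) 0.
  rewrite -fps_unitE; apply: (big_ind (fun f => f \is a GRing.unit)) => [||j _].
  - exact: unitr1.
  - by move=> f g uf ug; rewrite unitrM uf.
  by rewrite -exprS fps_unitE fcoefD fcoefN fcoef_exp_lt // subr0 unitr1.
(* The quotient of infinite products becomes the generating function of [t]-regular partitions. The
   commutation below makes the index [m] of the Cauchy product the removed part. *)
rewrite -partition_gf_regular // mulrK // -[in q / (1 - q)](expr1 q).
rewrite !fps_geometric // mulrC; apply: fpsP => n.
rewrite fcoefM /= bhookE.
rewrite (eq_big_seq (fun s => size (undup s))); last first.
  by move=> s; rewrite mem_partitions => /andP[/and3P[? ? _] _]; apply: hook_count1.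
rewrite sum_size_undup_partitions -natz natr_sum big_mkcond.
(* The difference of the geometric series for [k = 1] and [k = t] is the indicator of the positive
   [m] not divisible by [t]. *)
apply: eq_bigr => m _; rewrite dvd1n andbT natz.
by case: (0 < m)%N; case: (t %| m)%N; rewrite ?subrr ?subr0 ?mul0r ?mul1r.
Qed.
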